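(* Fix $\alpha\in(1,\sqrt2)$ and $y_1,y_2\in[0,1]$, and let $$f(\alpha,y_1,y_2)=4-y_1-y_2-\frac{2}{1+y_1y_2}\,\alpha^2 .$$ For every $\epsilon>0$ and $c>0$ there exist $\delta>0$ and $n_0>0$ such that for all $n\ge n_0$ and $k\le c\log n$, $$\left|\frac{\log \mathbb{E}\big[\,|\mathcal{O}(\alpha,y_1,y_2,\delta)|\,\big]}{k\log n}-f(\alpha,y_1,y_2)\right|<\epsilon .$$ As a result, when $f(\alpha,y_1,y_2)<0$, for every $\epsilon>0$ and $c>0$ there exist $\delta>0$ and $n_0>0$ such that for all $n\ge n_0$ and $k\le c\log n$, $$\mathbb{P}\big(\mathcal{O}(\alpha,y_1,y_2,\delta)\ne\emptyset\big)<\epsilon .$$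
   Context: $\mathbf{C}^n$ is an $n\times n$ matrix with i.i.d. standard normal entries, $[n]=\{1,\dots,n\}$, and $k$ is a positive integer. For $I,J\subset[n]$, $\mathbf{C}^n_{I,J}$ is the submatrix with rows $I$ and columns $J$. For $\delta>0$, $\mathcal{O}(\alpha,y_1,y_2,\delta)$ (which depends also on $n$ and $k$) denotes the random set of pairs of $k\times k$ submatrices $\mathbf{C}^n_{I_1,J_1},\mathbf{C}^n_{I_2,J_2}$ of $\mathbf{C}^n$ (with $|I_1|=|J_1|=|I_2|=|J_2|=k$) such that each of the two has average entry in the interval $\left[(\alpha-\delta)\sqrt{2\log n/k},\ (\alpha+\delta)\sqrt{2\log n/k}\right]$ and $|I_1\cap I_2|/k\in(y_1-\delta,y_1+\delta)$, $|J_1\cap J_2|/k\in(y_2-\delta,y_2+\delta)$. Pairs are ordered.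
   Formalization: The estimate of log E|O| is asserted only for those k for which each window (y_i−δ, y_i+δ), i=1,2, contains some m/k with 0≤m≤k; otherwise O is surely empty and log E|O| is undefined (e.g. k=1, y1=y2=1/2, δ≤1/2). *)

(* Defs.v *)
From mathcomp Require Import all_boot all_order all_algebra.
From mathcomp Require Import all_classical all_reals all_analysis.

Set Implicit Arguments.
Unset Strict Implicit.
Unset Printing Implicit Defensive.

Import Order.TTheory GRing.Theory Num.Theory.
Import numFieldNormedType.Exports.

Local Open Scope classical_set_scope.
Local Open Scope ring_scope.

Definition mutually_independent d (T : measurableType d) (R : realType)
    (P : probability T R) (I : finType) (X : I -> {RV P >-> R}) : Prop :=
  forall (J : {set I}) (B : I -> set R),
    (forall i, i \in J -> measurable (B i)) ->
    P (\bigcap_(i in [set` J]) (X i @^-1` B i)) =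
      (\prod_(i in J) P (X i @^-1` B i))%E.

Definition standard_gaussian_matrix d (T : measurableType d) (R : realType)
    (P : probability T R) (n : nat) (C : 'I_n -> 'I_n -> {RV P >-> R}) : Prop :=
  (forall i j (B : set R), measurable B ->
     distribution P (C i j) B = normal_prob 0 1 B) /\
  mutually_independent (fun ij : 'I_n * 'I_n => C ij.1 ij.2).

Section OverlapPairs.
Context {R : realType}.

Definition submx_avg n (M : 'M[R]_n) (I J : {set 'I_n}) : R :=
  (\sum_(i in I) \sum_(j in J) M i j) / (#|I| * #|J|)%:R.

(* A submatrix is represented by the pair (I, J) of its row and column sets. *)
Definition overlap_pairs n (M : 'M[R]_n) (k : nat) (alpha y1 y2 delta : R) :
    {set ({set 'I_n} * {set 'I_n}) * ({set 'I_n} * {set 'I_n})} :=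
  let s := Num.sqrt (2 * ln n%:R / k%:R) in
  let window := `[(alpha - delta) * s, (alpha + delta) * s] in
  [set p : ({set 'I_n} * {set 'I_n}) * ({set 'I_n} * {set 'I_n}) |
    let: ((I1, J1), (I2, J2)) := p in
    [&& #|I1| == k, #|J1| == k, #|I2| == k & #|J2| == k] &&
    [&& submx_avg M I1 J1 \in window,
        submx_avg M I2 J2 \in window,
        #|(I1 :&: I2)%SET|%:R / k%:R \in `]y1 - delta, y1 + delta[ &
        #|(J1 :&: J2)%SET|%:R / k%:R \in `]y2 - delta, y2 + delta[]]%SET.

(* Some overlap size m of two k-sets satisfies m / k \in `]y - delta, y + delta[.
   When this fails, overlap_pairs is empty for every matrix (for instance for
   k = 1, y1 = 1 / 2, delta <= 1 / 2) and the logarithm of its expected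
   cardinality is -oo. *)
Definition overlap_attainable (k : nat) (y delta : R) : Prop :=
  exists2 m : nat, (m <= k)%N & m%:R / k%:R \in `]y - delta, y + delta[.

Definition overlap_exponent (alpha y1 y2 : R) : R :=
  4 - y1 - y2 - 2 / (1 + y1 * y2) * alpha ^+ 2.

End OverlapPairs.

Definition random_overlap_pairs d (T : measurableType d) (R : realType)
    (P : probability T R) (n : nat) (C : 'I_n -> 'I_n -> {RV P >-> R})
    (k : nat) (alpha y1 y2 delta : R) (w : T) :=
  overlap_pairs (\matrix_(i, j) C i j w) k alpha y1 y2 delta.

(* Main.v *)
Require Import Defs.
From mathcomp Require Import all_boot all_order all_algebra.
From mathcomp Require Import all_classical all_reals all_analysis.
From mathcomp Require Import measurable_realfun.
From mathcomp Require Import ring lra zify.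

Set Implicit Arguments.
Unset Strict Implicit.
Unset Printing Implicit Defensive.

Import Order.TTheory GRing.Theory Num.Theory.
Import numFieldNormedType.Exports.

Local Open Scope classical_set_scope.
Local Open Scope ring_scope.

(** First moment. By independence, [k] times the averages of two [k]-by-[k]
    submatrices have the joint exponential moments of a standard Gaussian pair
    [(X, Y)] of correlation [rho = |I1 :&: I2| |J1 :&: J2| / k^2]. These moments
    are all that is used of the joint law. Markov's inequality for
    [expR (l * (X + Y))] gives [P (X, Y >= t) <= expR (- t^2 / (1 + rho))];
    tilting by the same weight with [l = t / (1 + rho)] gives the matching lower
    bound for a window around [t]. With [t = alpha * sqrt (2 k log n)] this is the
    term [- 2 alpha^2 / (1 + y1 y2)] of the exponent. The number of pairs of
    [k]-sets meeting in [m] points is [C(n, k) C(k, m) C(n - k, k - m)], that is,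
    [n^(2 k - m)] up to factors [2^k] and [k^(2 k)], which are negligible on the
    scale [k log n] because [k <= c log n]; rows and columns contribute
    [4 - y1 - y2]. *)

(** * Exponential moments of independent Gaussian variables *)

Section Density.
Local Open Scope ereal_scope.
Context d d' (T : measurableType d) (U : measurableType d') (R : realType).
Context (mu : {measure set T -> \bar R}) (nu : {measure set U -> \bar R}).
Variables (X : T -> U) (h : T -> R).
Hypothesis mX : measurable_fun setT X.
Hypothesis mh : measurable_fun setT h.
Hypothesis h0 : forall x, (0 <= h x)%R.
Hypothesis nuE : forall B, measurable B -> \int[mu]_(x in X @^-1` B) (h x)%:E = nu B.

Import HBNNSimple.

(** [nuE] says that [nu] is the image under [X] of the measure with density [h]; the identity passes
    from indicators to simple functions, then to [f] by monotone convergence. It is applied to the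
    Gaussian density ([X] the identity), to the law of an entry ([h] constant 1), and to independent
    products ([h] the remaining factors). *)
Lemma ge0_integral_density_comp (f : U -> \bar R) :
  (forall x, 0 <= f x) -> measurable_fun setT f ->
  \int[mu]_x (f (X x) * (h x)%:E) = \int[nu]_x f x.
Proof.
move=> f0 mf; pose g := nnsfun_approx measurableT mf.
have cg x : (g n x)%:E @[n --> \oo] --> f x.
  by apply: (cvg_nnsfun_approx measurableT mf).
have -> : \int[nu]_x f x = lim (\int[nu]_x (g n x)%:E @[n --> \oo]).
  under eq_integral => x _ do rewrite -(cvg_lim _ (cg x))//.
  apply: monotone_convergence => //.
  - by move=> n; exact/measurable_EFinP.
  - by move=> n x _; rewrite lee_fin.
  - by move=> x _ a b ab; rewrite lee_fin; exact/lefP/nd_nnsfun_approx.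
have -> : \int[mu]_x (f (X x) * (h x)%:E) =
    lim (\int[mu]_x ((g n (X x))%:E * (h x)%:E) @[n --> \oo]).
  have fg x : f (X x) * (h x)%:E = lim ((g n (X x))%:E * (h x)%:E @[n --> \oo]).
    by apply/esym/cvg_lim => //; apply: cvgeZr.
  under eq_integral => x _ do rewrite fg.
  apply: monotone_convergence => //.
  - move=> n; apply: emeasurable_funM; last exact/measurable_EFinP.
    by apply/measurable_EFinP; exact: measurableT_comp.
  - by move=> n x _; rewrite mule_ge0 ?lee_fin.
  - move=> x _ a b ab; rewrite lee_wpmul2r ?lee_fin//.
    exact/lefP/nd_nnsfun_approx.
(* Simple functions: expand over the finite range and apply [nuE] to each level set. *)
suff gE n : \int[mu]_x ((g n (X x))%:E * (h x)%:E) = \int[nu]_x (g n x)%:E.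
  by congr (lim _); under eq_fun do rewrite gE.
have ind0 r x : 0 <= (r * \1_(g n @^-1` [set r]) x)%:E.
  exact: nnfun_muleindic_ge0.
have mind r : measurable (g n @^-1` [set r]) by exact: measurable_sfunP.
have mindc r : measurable_fun setT (fun x => \1_(g n @^-1` [set r]) (X x) : R).
  by apply: measurableT_comp mX; exact: measurable_indic.
transitivity (\int[nu]_x
   (\sum_(y \in range (g n)) (y * \1_(g n @^-1` [set y]) x)%:E)); last first.
  by apply: eq_integral => t _; rewrite fimfunE -fsumEFin.
rewrite ge0_integral_fsum//; last first.
  by move=> r; apply/measurable_EFinP; apply: measurable_funM.
transitivity (\int[mu]_x (\sum_(y \in range (g n))
    (y * \1_(g n @^-1` [set y]) (X x))%:E * (h x)%:E)).
  apply: eq_integral => x _.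
  by rewrite -ge0_mule_fsuml// fsumEFin// -(fimfunE _ (X x)).
rewrite ge0_integral_fsum//; last 2 first.
  - move=> r; apply: emeasurable_funM; apply/measurable_EFinP => //.
    exact: measurable_funM.
  - by move=> r x _; apply: mule_ge0 => //; rewrite lee_fin.
apply: eq_fsbigr => r; rewrite inE => -[t _ rE].
have r0 : (0 <= r)%R by rewrite -rE.
under [RHS]eq_integral do rewrite EFinM.
rewrite ge0_integralZl//; last exact/measurable_EFinP/measurable_indic.
rewrite integral_indic// setIT -nuE//.
under eq_integral do rewrite EFinM -muleA.
rewrite ge0_integralZl//; first last.
- by move=> x _; rewrite mule_ge0 ?lee_fin.
- by apply: emeasurable_funM; exact/measurable_EFinP.
congr (_ * _).
rewrite [RHS]integral_mkcond; apply: eq_integral => x _.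
by rewrite epatch_indic muleC.
Qed.
End Density.

(** Completing the square: [expR (a * x)] times the standard density is [expR (a ^+ 2 / 2)] times
    the density of mean [a], whose integral is 1. *)
Lemma normal_prob_mgf (R : realType) (a : R) :
  (\int[normal_prob 0 1]_x (expR (a * x))%:E = (expR (a ^+ 2 / 2))%:E)%E.
Proof.
have mexp : measurable_fun setT (fun x : R => expR (a * x)).
  by apply: measurableT_comp => //; exact: measurable_funM.
rewrite -(@ge0_integral_density_comp _ _ _ _ _ lebesgue_measure (normal_prob 0 1)
  id (normal_pdf 0 1))//; first last.
- exact/measurable_EFinP.
- by move=> x; exact: normal_pdf_ge0.
- exact: measurable_normal_pdf.
transitivity (\int[lebesgue_measure]_x
    ((expR (a ^+ 2 / 2))%:E * (normal_pdf a 1 x)%:E))%E.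
  apply: eq_integral => x _; rewrite -!EFinM; congr (_%:E).
  rewrite !normal_pdfE ?oner_eq0// /normal_fun mulrCA [RHS]mulrCA -!expRD.
  by congr (_ * expR _); field.
rewrite ge0_integralZl//; last 2 first.
- by apply/measurable_EFinP; exact: measurable_normal_pdf.
- by move=> x _; rewrite lee_fin normal_pdf_ge0.
by rewrite integral_normal_pdf mule1.
Qed.

Section Independence.
Local Open Scope ereal_scope.
Context d (T : measurableType d) (R : realType) (P : probability T R).
Context (I : finType) (X : I -> {RV P >-> R}).
Hypothesis indX : mutually_independent X.
Variables (g : I -> R -> R) (M : I -> R).
Hypothesis mg : forall i, measurable_fun setT (g i).
Hypothesis g0 : forall i x, (0 <= g i x)%R.
Hypothesis EgM : forall i, \int[P]_w (g i (X i w))%:E = (M i)%:E.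

Let M0 i : (0 <= M i)%R.
Proof. by rewrite -lee_fin -EgM integral_ge0// => x _; rewrite lee_fin. Qed.

Let mgX i : measurable_fun setT (fun w => g i (X i w)).
Proof. by apply: measurableT_comp. Qed.

Let mXB i B : measurable B -> measurable (X i @^-1` B).
Proof. by move=> mB; rewrite -[X in measurable X]setTI; exact: measurable_funPT. Qed.

(** Independence is given for events only, so factors are integrated one at a time while the other
    indices may be constrained to events. To find the law of [X i0] under the weight formed by the
    remaining factors, one tests it on a set [D]; this moves [i0] from [r] into [J], and the
    induction hypothesis applies. *)
Lemma independent_integral_prod_restrict (r : seq I) (J : {set I}) (B : I -> set R) :
  uniq r -> {in r, forall i, i \notin J} -> (forall i, i \in J -> measurable (B i)) ->
  \int[P]_(w in \bigcap_(i in [set` J]) (X i @^-1` B i))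
      (\prod_(i <- r) g i (X i w))%:E =
  (\prod_(i in J) P (X i @^-1` B i)) * (\prod_(i <- r) M i)%:E.
Proof.
elim: r J B => [|i0 r IH] J B /=.
  move=> _ _ mB; under eq_integral do rewrite big_nil.
  rewrite integral_cst/=; last first.
    by apply: fin_bigcap_measurable => // i /= iJ; apply: mXB; exact: mB.
  by rewrite big_nil mul1e mule1; exact: indX.
move=> /andP[i0r ur] dis mB.
set F := \bigcap_(i in _) _.
have mF : measurable F.
  by apply: fin_bigcap_measurable => // i /= iJ; apply: mXB; exact: mB.
have i0J : i0 \notin J.
  exact/dis/mem_head.
have rJ : {in r, forall i, i \notin J}.
  by move=> i ir; apply: dis; rewrite inE ir orbT.
set p := \prod_(i in J) _.
have p0 : 0 <= p by exact: prode_ge0.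
have pfin : p \is a fin_num.
  rewrite /p -indX//; exact: fin_num_measure.
have c0 : (0 <= fine p * \prod_(i <- r) M i)%R.
  by rewrite mulr_ge0 ?fine_ge0// prodr_ge0.
pose h w := (\1_F w * \prod_(i <- r) g i (X i w))%R.
have mh : measurable_fun setT h.
  apply: measurable_funM; first exact: measurable_indic.
  exact: measurable_prod.
have h0 w : (0 <= h w)%R by rewrite mulr_ge0 ?prodr_ge0.
(* Under the weight [h] the image of [P] by [X i0] is [c] times the law of [X i0], where [c] is the
   probability of [F] times the remaining means. *)
pose c := NngNum c0.
have cE : c%:num%:E = p * (\prod_(i <- r) M i)%:E.
  by rewrite /c /= EFinM fineK.
have key := @ge0_integral_density_comp _ _ _ _ _ P
  (mscale c (distribution P (X i0))) (X i0) h _ mh h0.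
rewrite big_cons.
transitivity (\int[P]_w ((g i0 (X i0 w))%:E * (h w)%:E)).
  rewrite [LHS]integral_mkcond; apply: eq_integral => w _.
  rewrite epatch_indic big_cons -!EFinM /h; congr (_%:E); ring.
rewrite (key _ _ (EFin \o g i0)); first last.
- exact/measurable_EFinP.
- by move=> x /=; rewrite lee_fin.
- move=> D mD; rewrite /mscale/=.
  pose B' i := if i == i0 then D else B i.
  rewrite integral_mkcond.
  transitivity (\int[P]_(w in \bigcap_(i in [set` i0 |: J]) (X i @^-1` B' i))
      (\prod_(i <- r) g i (X i w))%:E).
    rewrite [RHS]integral_mkcond; apply: eq_integral => w _.
    rewrite !epatch_indic /h -!EFinM; congr (_%:E).
    suff -> : \bigcap_(i in [set` i0 |: J]) (X i @^-1` B' i) =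
       F `&` (X i0 @^-1` D) by rewrite indicI/=; ring.
    apply/seteqP; split => [x xB|x [xF xD] i].
      split; last first.
        by have := xB i0; rewrite /B' eqxx; apply => /=; rewrite setU11.
      move=> i /= iJ; have := xB i; rewrite /B'.
      case: eqP => [iE|_]; first by move: i0J; rewrite -iE iJ.
      by apply => /=; rewrite inE iJ orbT.
    rewrite /= !inE /B' => /orP[/eqP ->|iJ]; first by rewrite eqxx.
    case: eqP => [iE|_]; first by move: i0J; rewrite -iE iJ.
    exact: xF.
  rewrite IH//.
  + rewrite big_setU1//= {1}/B' eqxx.
    transitivity (c%:num%:E * P (X i0 @^-1` D)) => //.
    rewrite cE (eq_bigr (fun i => P (X i @^-1` B i))).
      by rewrite -/p muleC muleA muleC muleA muleC muleA.
    by move=> i iJ; rewrite /B'; case: eqP => [iE|//]; move: i0J; rewrite -iE iJ.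
  + move=> i ir; rewrite !inE negb_or rJ// andbT.
    by apply: contraNneq i0r => <-.
  + move=> i; rewrite !inE /B'; case: eqP => //= _; exact: mB.
- exact: measurable_funPT.
rewrite ge0_integral_mscale//; last 2 first.
- exact/measurable_EFinP.
- by move=> x _; rewrite lee_fin.
rewrite ge0_integral_pushforward//; last 2 first.
- exact/measurable_EFinP.
- by move=> x _; rewrite lee_fin.
by rewrite cE /= EgM EFinM -muleA; congr (_ * _); rewrite muleC.
Qed.

Lemma independent_integral_prod :
  \int[P]_w (\prod_i g i (X i w))%:E = (\prod_i M i)%:E.
Proof.
have := @independent_integral_prod_restrict (enum I) finset.set0 (fun=> setT).
rewrite big_set0 mul1e big_enum/= => <- //.
- rewrite (_ : \bigcap_(i in _) _ = setT).
    by apply: eq_integral => w _; rewrite big_enum.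
  by apply/seteqP; split=> x //= _ i /=; rewrite inE.
- exact: enum_uniq.
- by move=> i _; rewrite inE.
Qed.

End Independence.

Section GaussianMatrix.
Context d (T : measurableType d) (R : realType) (P : probability T R).
Context (n : nat) (C : 'I_n -> 'I_n -> {RV P >-> R}).
Hypothesis hC : standard_gaussian_matrix C.

Lemma gaussian_matrix_mgf (a : 'I_n * 'I_n -> R) :
  (\int[P]_w (expR (\sum_ij a ij * C ij.1 ij.2 w))%:E =
   (expR (\sum_ij a ij ^+ 2 / 2))%:E)%E.
Proof.
have [distC indC] := hC.
rewrite expR_sum.
rewrite -(@independent_integral_prod _ _ _ _ _ _ indC
  (fun ij x => expR (a ij * x)) (fun ij => expR (a ij ^+ 2 / 2))).
- by apply: eq_integral => w _; rewrite expR_sum.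
- by move=> ij; apply: measurableT_comp => //; exact: measurable_funM.
- by move=> ij x; exact: expR_ge0.
- move=> ij; rewrite -normal_prob_mgf.
  have mexp : measurable_fun setT (fun x : R => expR (a ij * x)).
    by apply: measurableT_comp => //; exact: measurable_funM.
  rewrite -(@ge0_integral_density_comp _ _ _ _ _ P (normal_prob 0 1)
    (C ij.1 ij.2) (cst 1))//; first last.
  + exact/measurable_EFinP.
  + move=> B mB; rewrite (integral_cst P _ 1)/= ?mul1e; first exact: distC.
    by rewrite -[X in measurable X]setTI; exact: measurable_funPT.
  + by move=> mT B mB; exact: (measurable_funPT (C ij.1 ij.2)).
  + by apply: eq_integral => w _; rewrite mule1.
Qed.

End GaussianMatrix.

(** * Gaussian pairs *)

Lemma measurable_pair_itv d (T : measurableType d) (R : realType)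
    (X Y : T -> R) (i : interval R) :
  measurable_fun setT X -> measurable_fun setT Y ->
  measurable [set w | X w \in i /\ Y w \in i].
Proof.
move=> mX mY.
have -> : [set w | X w \in i /\ Y w \in i] =
    (X @^-1` [set` i]) `&` (Y @^-1` [set` i]) by apply/seteqP; split.
by apply: measurableI; rewrite -[X in measurable X]setTI; [exact: mX|exact: mY].
Qed.

Section GaussianPair.
Context d (T : measurableType d) (R : realType) (P : probability T R).
Variables (X Y : T -> R) (rho : R).
Hypothesis mX : measurable_fun setT X.
Hypothesis mY : measurable_fun setT Y.
Hypothesis rho0 : 0 <= rho.
Hypothesis mgfXY : forall a b, (\int[P]_w (expR (a * X w + b * Y w))%:E =
  (expR ((a ^+ 2 + 2 * rho * a * b + b ^+ 2) / 2))%:E)%E.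

Let measurable_expR_affine a b c :
  measurable_fun setT (fun w => expR (c + (a * X w + b * Y w))).
Proof.
apply: measurableT_comp => //; apply: measurable_funD => //.
by apply: measurable_funD; apply: measurable_funM.
Qed.

Let integral_expR_affine a b c :
  (\int[P]_w (expR (c + (a * X w + b * Y w)))%:E =
   (expR (c + (a ^+ 2 + 2 * rho * a * b + b ^+ 2) / 2))%:E)%E.
Proof.
under eq_integral do rewrite expRD EFinM.
rewrite ge0_integralZl//.
- by rewrite mgfXY -EFinM expRD.
- have := measurable_expR_affine a b 0.
  by under eq_fun do rewrite add0r; move=> /measurable_EFinP.
Qed.

(** Markov's inequality for [expR (l * (X + Y))] gives the exponent
    [l ^+ 2 * (1 + rho) - 2 * l * t], which is least at [l = t / (1 + rho)]. *)
Lemma gaussian_pair_tail_le (t : R) : 0 <= t ->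
  (P [set w | X w \in `[t, +oo[ /\ Y w \in `[t, +oo[] <=
   (expR (- (t ^+ 2 / (1 + rho))))%:E)%E.
Proof.
move=> t0; set A := [set _ | _].
have r1 : 0 < 1 + rho by rewrite ltr_wpDr.
have mA : measurable A by exact: measurable_pair_itv.
pose l : R := t / (1 + rho).
have l0 : 0 <= l by rewrite divr_ge0// ltW.
rewrite -(setIT A) -integral_indic//.
have -> : - (t ^+ 2 / (1 + rho)) =
    - (2 * l * t) + (l ^+ 2 + 2 * rho * l * l + l ^+ 2) / 2.
  by rewrite /l; field; rewrite gt_eqF.
rewrite -integral_expR_affine; apply: ge0_le_integral => //.
- by apply/measurable_EFinP/measurable_indic.
- exact/measurable_EFinP.
- move=> w _; rewrite lee_fin indicE; case: (boolP (w \in A)) => /= [|_].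
    rewrite inE /A/= !in_itv/= !andbT => -[tX' tY']; rewrite -[leLHS]expR0 ler_expR.
    have := ler_wpM2l l0 tX'; have := ler_wpM2l l0 tY'; lra.
  exact: expR_ge0.
Qed.

(* Tilting by [expR (l * (X + Y))] moves both means to [t]; the exponential
   moments alone then bound the tilted mass outside the window. *)
Lemma gaussian_pair_window_ge (t v : R) : 0 <= t -> 0 <= v ->
  ((expR (- ((t ^+ 2 + 2 * t * v) / (1 + rho))) *
    (1 - 4 * expR (- (v ^+ 2 / 2))))%:E <=
   P [set w | (X w \in `[t - v, t + v] /\ Y w \in `[t - v, t + v])%R])%E.
Proof.
move=> t0 v0; set G := [set _ | _].
have r1 : 0 < 1 + rho by rewrite ltr_wpDr.
have mG : measurable G by exact: measurable_pair_itv.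
pose l : R := t / (1 + rho).
have l0 : 0 <= l by rewrite divr_ge0// ltW.
have tE : t = l * (1 + rho) by rewrite /l divfK// gt_eqF.
pose W c a b w := expR (c + (a * X w + b * Y w)).
have W0 c a b w : 0 <= W c a b w by exact: expR_ge0.
have mW c a b : measurable_fun setT (W c a b) by exact: measurable_expR_affine.
pose q := l ^+ 2 * (1 + rho).
(* All four weights used below, which shift one coordinate of the tilt by [v] or [- v], have this
   same integral because [t = l * (1 + rho)]. *)
have WE c a b : c + (a ^+ 2 + 2 * rho * a * b + b ^+ 2) / 2 = q - v ^+ 2 / 2 ->
    (\int[P]_w (W c a b w)%:E = (expR (q - v ^+ 2 / 2))%:E)%E.
  by move=> <-; rewrite integral_expR_affine.
pose K := expR (2 * l * (t + v)).
have K0 : 0 < K by exact: expR_gt0.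
have Kge0 : 0 <= K by exact: ltW.
pose S w := \1_G w * K + (W (- (v * (t + v))) (l + v) l w +
  (W (v * (t - v)) (l - v) l w + (W (- (v * (t + v))) l (l + v) w +
   W (v * (t - v)) l (l - v) w))).
(* Outside the window one of four one-sided bounds fails, and there a factor such as
   [expR (v * (X - t - v))] is at least 1. Inside it, the tilt is at most [K]. *)
have ptwise w : W 0 l l w <= S w.
  have S1 : forall c a b, (c + (a * X w + b * Y w) >= l * X w + l * Y w) ->
     W 0 l l w <= W c a b w.
    by move=> c a b h; rewrite ler_expR add0r.
  have I0 : 0 <= \1_G w * K by rewrite mulr_ge0// ltW.
  have [Xu|Xu] := ltP (t + v) (X w).
    have h : W 0 l l w <= W (- (v * (t + v))) (l + v) l w.
      by apply: S1; have := ler_wpM2l v0 (ltW Xu); lra.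
    by rewrite /S ler_wpDl// ler_wpDr// !addr_ge0.
  have [Xl|Xl] := ltP (X w) (t - v).
    have h : W 0 l l w <= W (v * (t - v)) (l - v) l w.
      by apply: S1; have := ler_wpM2l v0 (ltW Xl); lra.
    by rewrite /S ler_wpDl// ler_wpDl// ler_wpDr// addr_ge0.
  have [Yu|Yu] := ltP (t + v) (Y w).
    have h : W 0 l l w <= W (- (v * (t + v))) l (l + v) w.
      by apply: S1; have := ler_wpM2l v0 (ltW Yu); lra.
    by rewrite /S ler_wpDl// ler_wpDl// ler_wpDl// ler_wpDr.
  have [Yl|Yl] := ltP (Y w) (t - v).
    have h : W 0 l l w <= W (v * (t - v)) l (l - v) w.
      by apply: S1; have := ler_wpM2l v0 (ltW Yl); lra.
    by rewrite /S ler_wpDl// ler_wpDl// ler_wpDl// ler_wpDl.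
  have wG : w \in G by rewrite inE /G/= !in_itv/= Xu Xl Yu Yl.
  rewrite /S indicE wG mul1r ler_wpDr ?addr_ge0//.
  rewrite ler_expR add0r.
  have := ler_wpM2l l0 Xu; have := ler_wpM2l l0 Yu; lra.
have intS : (\int[P]_w (S w)%:E =
    P G * K%:E + (4 * expR (q - v ^+ 2 / 2))%:E)%E.
  have mGK : measurable_fun setT (fun w => \1_G w * K : R).
    by apply: measurable_funM => //; exact: measurable_indic.
  under eq_integral do rewrite /S !EFinD.
  rewrite !ge0_integralD//; do ?[by move=> w _; rewrite ?lee_fin ?addr_ge0 ?mulr_ge0//|
    by apply/measurable_EFinP; do ?apply: measurable_funD].
  rewrite !WE; do ?[by rewrite tE /q; field].
  under eq_integral do rewrite EFinM.
  rewrite ge0_integralZr//; last exact/measurable_EFinP/measurable_indic.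
  rewrite integral_indic// setIT; congr (_ + _)%E.
  by rewrite -!EFinD; congr (_%:E); ring.
have : ((expR q)%:E <= \int[P]_w (S w)%:E)%E.
  have -> : expR q = expR (0 + (l ^+ 2 + 2 * rho * l * l + l ^+ 2) / 2).
    by congr expR; rewrite /q; field.
  rewrite -integral_expR_affine; apply: ge0_le_integral => //.
  - exact/measurable_EFinP.
  - apply/measurable_EFinP; apply: measurable_funD.
      by apply: measurable_funM => //; exact: measurable_indic.
    by do ?apply: measurable_funD.
  - by move=> w _; rewrite lee_fin; exact: ptwise.
have PGf : P G \is a fin_num by exact: fin_num_measure.
rewrite intS -(fineK PGf) -EFinM -EFinD !lee_fin => h.
have -> : expR (- ((t ^+ 2 + 2 * t * v) / (1 + rho))) = expR q / K.
  rewrite /K -expRN -expRD; congr expR; rewrite /q {2}tE /l; field.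
  by rewrite gt_eqF.
rewrite -(ler_pM2r K0) mulrAC divfK ?gt_eqF//.
by move: h; rewrite expRD; lra.
Qed.

End GaussianPair.

(** * Joint law of two submatrix averages *)

Section Submatrix.
Context d (T : measurableType d) (R : realType) (P : probability T R).
Context (n : nat) (C : 'I_n -> 'I_n -> {RV P >-> R}).

Let e (I J : {set 'I_n}) (ij : 'I_n * 'I_n) : R :=
  ((ij.1 \in I) && (ij.2 \in J))%:R.

Let sum_e I J (F : 'I_n -> 'I_n -> R) :
  \sum_ij e I J ij * F ij.1 ij.2 = \sum_(i in I) \sum_(j in J) F i j.
Proof.
rewrite pair_big_dep/= big_mkcond/= [RHS]big_mkcond/=.
by apply: eq_bigr => -[i j] _; rewrite /e/=; case: ifP; rewrite ?mul1r ?mul0r.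
Qed.

Let sum_e1 I J : \sum_ij e I J ij = (#|I| * #|J|)%:R.
Proof.
under eq_bigr do rewrite -[e _ _ _]mulr1.
rewrite (sum_e _ _ (fun _ _ => 1)).
under eq_bigr do rewrite sumr_const.
by rewrite sumr_const mulnC mulrnA.
Qed.

Let eM I1 J1 I2 J2 ij :
  e I1 J1 ij * e I2 J2 ij = e (I1 :&: I2)%SET (J1 :&: J2)%SET ij.
Proof. by rewrite /e !inE -natrM mulnb andbACA. Qed.

(** The factor [k] gives variance 1 when both sets have [k] elements: a sum of [k ^ 2] independent
    entries divided by [k]. *)
Definition normalized_submx_sum (k : nat) (I J : {set 'I_n}) (w : T) : R :=
  k%:R * submx_avg (\matrix_(i, j) C i j w) I J.

Lemma normalized_submx_sumE (k : nat) (I J : {set 'I_n}) (w : T) :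
  (0 < k)%N -> #|I| = k -> #|J| = k ->
  normalized_submx_sum k I J w = (\sum_(i in I) \sum_(j in J) C i j w) / k%:R.
Proof.
move=> k0 Ik Jk; rewrite /normalized_submx_sum /submx_avg Ik Jk natrM.
have kn0 : k%:R != 0 :> R by rewrite pnatr_eq0 -lt0n.
under eq_bigr do under eq_bigr do rewrite mxE.
by field.
Qed.

Lemma measurable_submx_avg (I J : {set 'I_n}) :
  measurable_fun setT (fun w => submx_avg (\matrix_(i, j) C i j w) I J).
Proof.
apply: measurable_funM => //.
under eq_fun do rewrite -big_enum/=; apply: measurable_sum => i.
under eq_fun do rewrite -big_enum/=; apply: measurable_sum => j.
by under eq_fun do rewrite mxE; exact: measurable_funPT.
Qed.

Lemma measurable_normalized_submx_sum (k : nat) (I J : {set 'I_n}) :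
  measurable_fun setT (normalized_submx_sum k I J).
Proof. by apply: measurable_funM => //; exact: measurable_submx_avg. Qed.

(** The exponent is a linear form in the entries. Squaring its coefficients, the cross term is the
    indicator of the common block, with [#|I1 :&: I2| * #|J1 :&: J2|] cells; hence [rho]. *)
Lemma normalized_submx_sum_mgf (hC : standard_gaussian_matrix C) (k : nat)
    (I1 J1 I2 J2 : {set 'I_n}) (a b : R) :
  (0 < k)%N -> #|I1| = k -> #|J1| = k -> #|I2| = k -> #|J2| = k ->
  let rho := #|(I1 :&: I2)%SET|%:R / k%:R * (#|(J1 :&: J2)%SET|%:R / k%:R) in
  (\int[P]_w (expR (a * normalized_submx_sum k I1 J1 w
                  + b * normalized_submx_sum k I2 J2 w))%:E =
   (expR ((a ^+ 2 + 2 * rho * a * b + b ^+ 2) / 2))%:E)%E.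
Proof.
move=> k0 I1k J1k I2k J2k rho.
have kn0 : k%:R != 0 :> R by rewrite pnatr_eq0 -lt0n.
pose c ij := (a * e I1 J1 ij + b * e I2 J2 ij) / k%:R.
transitivity (\int[P]_w (expR (\sum_ij c ij * C ij.1 ij.2 w))%:E)%E.
  apply: eq_integral => w _; congr ((expR _)%:E).
  rewrite !normalized_submx_sumE// -!sum_e.
  under [RHS]eq_bigr do rewrite /c mulrAC mulrDl -!mulrA.
  by rewrite -mulr_suml big_split/= -!mulr_sumr; field.
rewrite gaussian_matrix_mgf//; congr ((expR _)%:E).
transitivity (\sum_ij (a ^+ 2 * e I1 J1 ij
    + 2 * a * b * e (I1 :&: I2)%SET (J1 :&: J2)%SET ij
    + b ^+ 2 * e I2 J2 ij) / (k%:R ^+ 2 * 2)).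
  apply: eq_bigr => ij _; rewrite -eM /c.
  have e2 I J : e I J ij = e I J ij ^+ 2 by rewrite expr2 eM !finset.setIid.
  by rewrite {2}(e2 I1 J1) {3}(e2 I2 J2); field.
rewrite -mulr_suml !big_split/= -!mulr_sumr !sum_e1 I1k J1k I2k J2k !natrM /rho.
by field.
Qed.

(** The random part of the condition in [overlap_pairs]; sizes and overlaps of the index sets are
    deterministic and are handled by counting. *)
Definition avg_window_event (k : nat) (alpha delta : R)
    (p : ({set 'I_n} * {set 'I_n}) * ({set 'I_n} * {set 'I_n})) : set T :=
  let s := Num.sqrt (2 * ln n%:R / k%:R) in
  let window := `[(alpha - delta) * s, (alpha + delta) * s] in
  [set w | submx_avg (\matrix_(i, j) C i j w) p.1.1 p.1.2 \in window /\
           submx_avg (\matrix_(i, j) C i j w) p.2.1 p.2.2 \in window].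

Lemma measurable_avg_window_event k alpha delta p :
  measurable (avg_window_event k alpha delta p).
Proof. by apply: measurable_pair_itv; exact: measurable_submx_avg. Qed.

Section Event.
Hypothesis hC : standard_gaussian_matrix C.
Variables (k : nat) (p : ({set 'I_n} * {set 'I_n}) * ({set 'I_n} * {set 'I_n})).
Hypothesis k0 : (0 < k)%N.
Hypotheses (I1k : #|p.1.1| = k) (J1k : #|p.1.2| = k).
Hypotheses (I2k : #|p.2.1| = k) (J2k : #|p.2.2| = k).

Let s : R := Num.sqrt (2 * ln n%:R / k%:R).
Let rho : R :=
  #|(p.1.1 :&: p.2.1)%SET|%:R / k%:R * (#|(p.1.2 :&: p.2.2)%SET|%:R / k%:R).

Let rho0 : 0 <= rho. Proof. by rewrite mulr_ge0// divr_ge0. Qed.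
Let kn0 : 0 < k%:R :> R. Proof. by rewrite ltr0n. Qed.

Let L0 : 0 <= ln n%:R :> R.
Proof. by case: n => [|m]; [rewrite ln0|rewrite ln_ge0// ler1n]. Qed.

Let ks2 : (k%:R * s) ^+ 2 = 2 * (k%:R * ln n%:R).
Proof.
rewrite exprMn sqr_sqrtr; last by rewrite divr_ge0// mulr_ge0.
by field; rewrite gt_eqF.
Qed.

Let mgf a b := normalized_submx_sum_mgf hC a b k0 I1k J1k I2k J2k.

(** The window is enlarged to a half-line, and the tail bound is taken at
    [t = (alpha - delta) * (k * s)], where [k * s] is [sqrt (2 k log n)]. *)
Lemma avg_window_event_le (alpha delta : R) : delta <= alpha ->
  (P (avg_window_event k alpha delta p) <=
   (expR (- (2 * (alpha - delta) ^+ 2 / (1 + rho) * (k%:R * ln n%:R))))%:E)%E.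
Proof.
move=> da.
have t0 : 0 <= (alpha - delta) * (k%:R * s).
  by rewrite mulr_ge0 ?subr_ge0// mulr_ge0 ?sqrtr_ge0.
have := gaussian_pair_tail_le (measurable_normalized_submx_sum k p.1.1 p.1.2)
  (measurable_normalized_submx_sum k p.2.1 p.2.2) rho0 mgf t0.
rewrite exprMn ks2 => h.
have -> : 2 * (alpha - delta) ^+ 2 / (1 + rho) * (k%:R * ln n%:R) =
  (alpha - delta) ^+ 2 * (2 * (k%:R * ln n%:R)) / (1 + rho) by ring.
apply: le_trans h; apply: le_measure; rewrite ?inE.
- exact: measurable_avg_window_event.
- by apply: measurable_pair_itv; exact: measurable_normalized_submx_sum.
move=> w /= []; rewrite !in_itv/= !andbT => /andP[h1 _] /andP[h2 _].
by rewrite /normalized_submx_sum mulrCA !ler_pM2l.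
Qed.

(** The window bound at center [t = alpha * (k * s)] and half-width [v = delta * (k * s)]. *)
Lemma avg_window_event_ge (alpha delta : R) : 0 <= delta -> 0 <= alpha ->
  ((expR (- (2 * (alpha ^+ 2 + 2 * alpha * delta) / (1 + rho) * (k%:R * ln n%:R))) *
    (1 - 4 * expR (- (delta ^+ 2 * (k%:R * ln n%:R)))))%:E <=
   P (avg_window_event k alpha delta p))%E.
Proof.
move=> d0 a0.
have ks0 : 0 <= k%:R * s by rewrite mulr_ge0 ?sqrtr_ge0.
have t0 : 0 <= alpha * (k%:R * s) by rewrite mulr_ge0.
have v0 : 0 <= delta * (k%:R * s) by rewrite mulr_ge0.
have := gaussian_pair_window_ge (measurable_normalized_submx_sum k p.1.1 p.1.2)
  (measurable_normalized_submx_sum k p.2.1 p.2.2) rho0 mgf t0 v0.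
have -> : (alpha * (k%:R * s)) ^+ 2 + 2 * (alpha * (k%:R * s)) * (delta * (k%:R * s)) =
  (alpha ^+ 2 + 2 * alpha * delta) * (k%:R * s) ^+ 2 by ring.
rewrite [(delta * _) ^+ 2]exprMn ks2 => h.
have -> : 2 * (alpha ^+ 2 + 2 * alpha * delta) / (1 + rho) * (k%:R * ln n%:R) =
  (alpha ^+ 2 + 2 * alpha * delta) * (2 * (k%:R * ln n%:R)) / (1 + rho) by ring.
have -> : delta ^+ 2 * (k%:R * ln n%:R) =
  delta ^+ 2 * (2 * (k%:R * ln n%:R)) / 2 by field.
apply: le_trans h _; apply: le_measure; rewrite ?inE.
- by apply: measurable_pair_itv; exact: measurable_normalized_submx_sum.
- exact: measurable_avg_window_event.
move=> w; rewrite /avg_window_event/= /normalized_submx_sum !in_itv/= -mulrBl -mulrDl.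
by rewrite ![(_ * (k%:R * s))]mulrCA !ler_pM2l.
Qed.

End Event.
End Submatrix.

(** * Counting pairs of subsets *)

Section Counting.
Local Open Scope nat_scope.

Lemma leq_expn2r m1 m2 e : m1 <= m2 -> m1 ^ e <= m2 ^ e.
Proof. by case: e => // e; rewrite leq_exp2r. Qed.

Lemma expn_le_ffact N j : (N - j) ^ j <= N ^_ j.
Proof.
elim: j N => [|j IH] [|N]; rewrite ?ffactn0// ?exp0n// ffactSS expnS subSS.
by rewrite leq_mul// (leq_trans (leq_subr _ _)).
Qed.

Lemma fact_le_expn j k : j <= k -> j`! <= k ^ j.
Proof.
elim: j => // j IH jk; rewrite factS expnS leq_mul// IH// ltnW//.
Qed.

Lemma expn_le_bin N j k : j <= k -> (N - j) ^ j <= k ^ j * 'C(N, j).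
Proof.
move=> jk; rewrite (leq_trans (expn_le_ffact _ _))// -bin_ffact mulnC.
by rewrite leq_mul2r fact_le_expn// orbT.
Qed.

Lemma bin_le_expn N j : 'C(N, j) <= N ^ j.
Proof.
have h : N ^_ j <= N ^ j.
  elim: j N => [|j IH] [|N]; rewrite ?ffactn0// ?exp0n// ffactSS expnS leq_mul//.
  by rewrite (leq_trans (IH N))// leq_expn2r.
by apply: leq_trans h; rewrite -bin_ffact leq_pmulr// fact_gt0.
Qed.

Variable n : nat.

(** Serves for rows and for columns. The predicate [Q] allows both a prescribed overlap size and a
    range of sizes. *)
Definition ksubset_pairs (k : nat) (Q : pred nat) : {set {set 'I_n} * {set 'I_n}} :=
  [set q : {set 'I_n} * {set 'I_n} |
    [&& #|q.1| == k, #|q.2| == k & Q #|(q.1 :&: q.2)%SET|]]%SET.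

(** A set [I'] is determined by its trace on [I], an [m]-subset, and its part outside [I], a
    [(k - m)]-subset of the complement; union is the inverse map. *)
Lemma card_ksubsets_meet (k m : nat) (I : {set 'I_n}) : #|I| = k -> m <= k ->
  #|[set I' : {set 'I_n} | (#|I'| == k) && (#|(I :&: I')%SET| == m)]%SET|
    = 'C(k, m) * 'C(n - k, k - m).
Proof.
move=> Ik mk.
pose D1 := [set A : {set 'I_n} | A \subset I & #|A| == m]%SET.
pose D2 := [set A : {set 'I_n} | A \subset ~: I & #|A| == (k - m)%N]%SET.
have D1P A : A \in D1 -> A \subset I by rewrite inE => /andP[].
have D2P A : A \in D2 -> A \subset ~: I by rewrite inE => /andP[].
have -> : 'C(k, m) * 'C(n - k, k - m) = #|finset.setX D1 D2|.
  by rewrite cardsX !cards_draws Ik cardsCs finset.setCK Ik card_ord.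
have UI (A B : {set 'I_n}) : A \subset I -> B \subset ~: I ->
    ((A :|: B) :&: I = A /\ (A :|: B) :\: I = B)%SET.
  move=> AI BI; split.
    rewrite finset.setIUl (finset.setIidPl AI).
    move: BI; rewrite -finset.disjoints_subset -finset.setI_eq0 => /eqP ->.
    by rewrite finset.setU0.
  rewrite finset.setDUl [(B :\: I)%SET]finset.setDE (finset.setIidPl BI).
  by move: AI; rewrite -finset.setD_eq0 => /eqP ->; rewrite finset.set0U.
rewrite -(@card_in_imset _ _ (fun q => (q.1 :|: q.2)%SET)); last first.
  move=> [A B] [A' B']; rewrite !finset.in_setX /=.
  move=> /andP[/D1P AI /D2P BI] /andP[/D1P AI' /D2P BI'] /= AB.
  have [A1 B1] := UI _ _ AI BI; have [A2 B2] := UI _ _ AI' BI'.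
  by move: A1 B1; rewrite AB A2 B2 => -> ->.
congr #|pred_of_set _|; apply/setP => I'; rewrite inE.
apply/andP/imsetP => [[/eqP I'k /eqP I'm]|[[A B]]].
  exists (I' :&: I, I' :\: I)%SET; last by rewrite /= finset.setID.
  rewrite finset.in_setX !inE finset.subsetIr cardsD I'k finset.setIC I'm !eqxx.
  by rewrite finset.setDE finset.subsetIr.
rewrite finset.in_setX /= !inE => /andP[/andP[AI /eqP Am] /andP[BI /eqP Bm]] ->.
have [A1 B1] := UI _ _ AI BI.
by rewrite finset.setIC A1 -(cardsID I) A1 B1 Am Bm subnKC// !eqxx.
Qed.

Lemma card_ksubset_pairs_eq (k m : nat) : m <= k ->
  #|ksubset_pairs k (pred1 m)| = 'C(n, k) * ('C(k, m) * 'C(n - k, k - m)).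
Proof.
move=> mk; rewrite -sum1_card.
transitivity (\sum_(I : {set 'I_n} | #|I| == k)
  \sum_(I' in [set I' : {set 'I_n} | (#|I'| == k) && (#|(I :&: I')%SET| == m)]%SET) 1).
  by rewrite pair_big_dep/=; apply: eq_bigl => q; rewrite !inE.
under eq_bigr => I /eqP Ik do rewrite sum1_card card_ksubsets_meet//.
rewrite sum_nat_const; congr (_ * _).
transitivity #|[set I : {set 'I_n} | #|I| == k]%SET|.
  by apply: eq_card => I; rewrite inE.
by rewrite card_draws card_ord.
Qed.

Lemma card_ksubset_pairs_split (k : nat) (Q : pred nat) :
  #|ksubset_pairs k Q| = \sum_(m < k.+1 | Q m) #|ksubset_pairs k (pred1 (m : nat))|.
Proof.
have le_meet q : q \in ksubset_pairs k Q -> #|(q.1 :&: q.2)%SET| < k.+1.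
  rewrite inE => /and3P[/eqP <- _ _].
  by rewrite ltnS subset_leq_card// finset.subsetIl.
rewrite -sum1_card (partition_big (fun q => inord #|(q.1 :&: q.2)%SET|)
   (fun m : 'I_k.+1 => Q m)) /=; last first.
  move=> q qQ; rewrite inordK ?le_meet//; by move: qQ; rewrite inE => /and3P[].
apply: eq_bigr => m Qm; rewrite sum1_card; apply: eq_card => q.
rewrite [LHS]unfold_in /= [RHS]inE; apply/andP/and3P.
  move=> [qQ /eqP <-]; rewrite inordK ?le_meet//.
  by move: qQ; rewrite inE => /and3P[-> ->] /=.
move=> [qk qk' /eqP qm].
split; last by rewrite qm inord_val.
by rewrite inE qk qk' qm.
Qed.

(** In the exact count, ['C(k, m)] is bounded below by 1 and the other two binomials by powers;
    [n - 2k] is below both bases that arise. *)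
Lemma card_ksubset_pairs_ge (k m : nat) : m <= k ->
  (n - k.*2) ^ (k + (k - m)) <= k ^ (k + (k - m)) * #|ksubset_pairs k (pred1 m)|.
Proof.
move=> mk; rewrite card_ksubset_pairs_eq// !expnD.
have h1 : (n - k.*2) ^ k <= k ^ k * 'C(n, k).
  apply: leq_trans (expn_le_bin n (leqnn k)).
  by apply: leq_expn2r; rewrite leq_sub2l// -addnn leq_addr.
have h2 : (n - k.*2) ^ (k - m) <= k ^ (k - m) * 'C(n - k, k - m).
  apply: leq_trans (expn_le_bin (n - k) (leq_subr m k)).
  by apply: leq_expn2r; rewrite -subnDA leq_sub2l// -addnn leq_add2l leq_subr.
have h3 : 0 < 'C(k, m) by rewrite bin_gt0.
apply: (leq_trans (leq_mul h1 h2)); rewrite mulnACA leq_mul2l leq_mul2l.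
by rewrite leq_pmull// !orbT.
Qed.

End Counting.

(** The factors ['C(k, m)] are kept while summing over [m]: their sum is at most [2 ^ k], and the
    other two binomials are at most [n ^ k] and [n ^ (k - m)]. *)
Lemma card_ksubset_pairs_le (R : realType) (n k : nat) (Q : pred nat) (B : R) :
  0 <= B -> (forall m, (m <= k)%N -> Q m -> (n ^ (k - m))%:R <= B) ->
  #|ksubset_pairs n k Q|%:R <= (n ^ k)%:R * (2 ^ k)%:R * B.
Proof.
move=> B0 hB; rewrite card_ksubset_pairs_split natr_sum.
have -> : (2 ^ k)%:R = \sum_(m < k.+1) ('C(k, m))%:R :> R.
  rewrite -natr_sum (_ : 2 = 1 + 1)%N// expnDn; congr (_%:R).
  by apply: eq_bigr => i _; rewrite !exp1n !muln1.
rewrite mulr_sumr mulr_suml big_mkcond/=; apply: ler_sum => m _.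
case: ifPn => [Qm|_]; last by rewrite !mulr_ge0.
have mk : (m <= k)%N by rewrite -ltnS.
rewrite card_ksubset_pairs_eq// !natrM mulrA.
rewrite ler_pM ?mulr_ge0// ?ler_wpM2r// ?ler_nat ?bin_le_expn//.
rewrite (le_trans _ (hB m mk Qm))// ler_nat (leq_trans (bin_le_expn _ _))//.
by apply: leq_expn2r; rewrite leq_subr.
Qed.

(** Regroups two submatrices into a pair of row sets and a pair of column sets, so that the count
    becomes a product. *)
Definition row_col_pairs (n : nat) (A B : {set {set 'I_n} * {set 'I_n}}) :
    {set ({set 'I_n} * {set 'I_n}) * ({set 'I_n} * {set 'I_n})} :=
  [set p : ({set 'I_n} * {set 'I_n}) * ({set 'I_n} * {set 'I_n}) |
    ((p.1.1, p.2.1) \in A) && ((p.1.2, p.2.2) \in B)]%SET.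

Lemma card_row_col_pairs (n : nat) (A B : {set {set 'I_n} * {set 'I_n}}) :
  #|row_col_pairs A B| = (#|A| * #|B|)%N.
Proof.
rewrite -cardsX.
pose f (p : ({set 'I_n} * {set 'I_n}) * ({set 'I_n} * {set 'I_n})) :=
  ((p.1.1, p.2.1), (p.1.2, p.2.2)).
have fK : involutive f by move=> [[? ?] [? ?]].
rewrite -(card_imset _ (inv_inj fK)); apply: eq_card => -[a b].
rewrite finset.in_setX; apply/imsetP/idP => [[q]|abAB].
  by rewrite inE => qAB [-> ->].
exists (f (a, b)); last by rewrite fK.
by rewrite inE /= -!surjective_pairing.
Qed.

(** * The expected count as a sum of probabilities *)

Section ExpectedCount.
Context d (T : measurableType d) (R : realType) (P : probability T R).
Context (n : nat) (C : 'I_n -> 'I_n -> {RV P >-> R}).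
Variables (k : nat) (alpha y1 y2 delta : R).

Definition overlap_near (y : R) (m : nat) : bool :=
  m%:R / k%:R \in `]y - delta, y + delta[.

(** The pairs allowed by the deterministic conditions: a fixed index set over which the count is a
    sum of indicators. *)
Definition overlap_shapes :=
  row_col_pairs (ksubset_pairs n k (overlap_near y1))
                (ksubset_pairs n k (overlap_near y2)).

Let count w : R := #|random_overlap_pairs C k alpha y1 y2 delta w|%:R.

Let event := avg_window_event C k alpha delta.

Let measurable_event p : measurable (event p).
Proof. exact: measurable_avg_window_event. Qed.

Let countE w : count w = \sum_(p in overlap_shapes) \1_(event p) w.
Proof.
rewrite /count -sum1_card natr_sum big_mkcond [RHS]big_mkcond/=.
apply: eq_bigr => p _; rewrite indicE.
have -> : (w \in event p) =
    ((submx_avg (\matrix_(i, j) C i j w) p.1.1 p.1.2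
      \in `[(alpha - delta) * Num.sqrt (2 * ln n%:R / k%:R),
            (alpha + delta) * Num.sqrt (2 * ln n%:R / k%:R)]) &&
    (submx_avg (\matrix_(i, j) C i j w) p.2.1 p.2.2
      \in `[(alpha - delta) * Num.sqrt (2 * ln n%:R / k%:R),
            (alpha + delta) * Num.sqrt (2 * ln n%:R / k%:R)])).
  by apply/idP/andP; rewrite inE.
case: p => [[I1 J1] [I2 J2]].
rewrite /overlap_shapes /row_col_pairs /random_overlap_pairs /overlap_pairs.
rewrite !finset.in_set /= /overlap_near.
(* Only the order of the eight conditions differs between the two sides, so they are abstracted to
   booleans and checked by cases. *)
move: (submx_avg _ I1 J1 \in _) (submx_avg _ I2 J2 \in _) => u1 u2.
move: (_ \in `]y1 - delta, _[) (_ \in `]y2 - delta, _[) => v1 v2.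
move: (#|I1| == k) (#|J1| == k) (#|I2| == k) (#|J2| == k) => c1 c2 c3 c4.
by case: c1; case: c2; case: c3; case: c4; case: v1; case: v2; case: u1; case: u2.
Qed.

Let event_ge0 p : (0 <= P (event p))%E. Proof. exact: measure_ge0. Qed.

Let expectationE : ('E_P[count] = \sum_(p in overlap_shapes) P (event p))%E.
Proof.
rewrite unlock; under eq_integral do rewrite countE -big_enum/= -sumEFin.
rewrite ge0_integral_sum//.
  by rewrite big_enum/=; apply: eq_bigr => p _; rewrite integral_indic// setIT.
by move=> p; apply/measurable_EFinP; exact: measurable_indic.
Qed.

Lemma expected_overlap_count_le (B : R) :
  (forall p, p \in overlap_shapes ->
    (P (avg_window_event C k alpha delta p) <= B%:E)%E) ->
  ('E_P[count] <= (#|overlap_shapes|%:R * B)%:E)%E.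
Proof.
move=> hB; rewrite expectationE (le_trans (lee_sum _ hB))//.
by rewrite sumEFin sumr_const mulr_natl.
Qed.

(** All terms are nonnegative, so a convenient subfamily [S] suffices; it will be the pairs with one
    chosen overlap size for rows and one for columns. *)
Lemma expected_overlap_count_ge (B : R)
    (S : {set ({set 'I_n} * {set 'I_n}) * ({set 'I_n} * {set 'I_n})}) :
  S \subset overlap_shapes ->
  (forall p, p \in S -> (B%:E <= P (avg_window_event C k alpha delta p))%E) ->
  ((#|S|%:R * B)%:E <= 'E_P[count])%E.
Proof.
move=> SO hB; rewrite expectationE.
apply: (@le_trans _ _ (\sum_(p in S) P (event p))%E).
  by rewrite mulr_natl -sumr_const -sumEFin; exact: lee_sum.
by rewrite [leRHS](big_setID S)/= (finset.setIidPr SO) leeDl// sume_ge0.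
Qed.

(** First moment method: a cardinality that is not 0 is at least 1, so the indicator of the event is
    below the count. *)
Lemma overlap_nonempty_le_expectation :
  (P [set w | random_overlap_pairs C k alpha y1 y2 delta w != finset.set0] <=
   'E_P[count])%E.
Proof.
have mcount : measurable_fun setT count.
  have -> : count = fun w => \sum_(p <- enum overlap_shapes) \1_(event p) w.
    by apply/funext => w; rewrite countE big_enum.
  by apply: measurable_sum => p; exact: measurable_indic.
set A := [set _ | _].
have mA : measurable A.
  have -> : A = count @^-1` `]0, +oo[.
    by apply/seteqP; split => w /=; rewrite in_itv/= andbT ltr0n card_gt0.
  by rewrite -[X in measurable X]setTI; exact: mcount.
rewrite -(setIT A) -integral_indic// unlock; apply: ge0_le_integral => //.
- exact/measurable_EFinP/measurable_indic.
- exact/measurable_EFinP.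
move=> w _; rewrite lee_fin indicE; case: (boolP (w \in A)) => //.
by rewrite inE /A/= -card_gt0 ler1n.
Qed.

End ExpectedCount.

(** * Exponential bounds on the expected count *)

Section ExponentPerturbation.
Variable R : realType.
Implicit Types p q e alpha delta : R.

(** On nonnegative arguments [x |-> 1 / (1 + x)] is decreasing and 1-Lipschitz. *)
Lemma inv1D_perturb p q e : 0 <= p -> 0 <= q -> 0 <= e -> p <= q + e ->
  (1 + q)^-1 - e <= (1 + p)^-1.
Proof.
move=> p0 q0 e0 pq.
have q1 : 0 < 1 + q by lra.
have p1 : 0 < 1 + p by lra.
have uv0 : 0 <= (1 + q)^-1 * (1 + p)^-1 by rewrite mulr_ge0// invr_ge0 ltW.
have uv1 : (1 + q)^-1 * (1 + p)^-1 <= 1.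
  by apply: mulr_ile1; rewrite ?invr_ge0 ?(ltW q1) ?(ltW p1) ?invf_le1 ?lerDl.
have uvE : (1 + q)^-1 - (1 + p)^-1 = (1 + q)^-1 * (1 + p)^-1 * (p - q).
  by field; rewrite !gt_eqF.
have h1 := ler_wpM2l uv0 (_ : p - q <= e).
have h2 := ler_wpM2r e0 uv1.
have : p - q <= e by lra.
by move/h1; lra.
Qed.

(** Meant for [q = y1 * y2] and [p] the overlap product of an actual pair. The constant is 18 = 12 +
    6: the overlap error costs [6 * alpha ^+ 2 * delta], and the shift of [alpha] costs
    [4 * alpha * delta] with [alpha <= 3 / 2]. *)
Lemma tail_exponent_ge alpha delta p q : 0 < alpha -> alpha ^+ 2 <= 2 ->
  0 <= delta -> 0 <= p -> 0 <= q -> p <= q + 3 * delta ->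
  2 / (1 + q) * alpha ^+ 2 - 18 * delta <= 2 * (alpha - delta) ^+ 2 / (1 + p).
Proof.
move=> a0 a2 d0 p0 q0 pq.
have h := inv1D_perturb p0 q0 (mulr_ge0 (ler0n _ 3) d0) pq.
have v0 : 0 <= (1 + p)^-1 by rewrite invr_ge0 addr_ge0.
have v1 : (1 + p)^-1 <= 1 by rewrite invf_le1 ?lerDl// ltr_wpDr.
have a32 : alpha <= 3 / 2 by nra.
set v := (1 + p)^-1 in h v0 v1 *; set u := (1 + q)^-1 in h *.
have h1 : alpha ^+ 2 * (u - 3 * delta) <= alpha ^+ 2 * v by rewrite ler_wpM2l// sqr_ge0.
have h2 : alpha ^+ 2 * delta <= 2 * delta by rewrite ler_wpM2r.
have h3 : alpha * delta <= 3 / 2 * delta by rewrite ler_wpM2r.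
have h4 : alpha * delta * v <= alpha * delta by rewrite ler_piMr// mulr_ge0// ltW.
have h5 : 0 <= delta ^+ 2 * v by rewrite mulr_ge0// sqr_ge0.
have -> : 2 * (alpha - delta) ^+ 2 * v =
  2 * (alpha ^+ 2 * v) - 4 * (alpha * delta * v) + 2 * (delta ^+ 2 * v) by ring.
have -> : 2 * u * alpha ^+ 2 =
  2 * (alpha ^+ 2 * (u - 3 * delta)) + 6 * (alpha ^+ 2 * delta) by ring.
by lra.
Qed.

(** The same two errors, 12 from the overlaps and 6 from the window, in the other direction. *)
Lemma window_exponent_le alpha delta p q : 0 < alpha -> alpha ^+ 2 <= 2 ->
  0 <= delta -> 0 <= p -> 0 <= q -> q <= p + 3 * delta ->
  2 * (alpha ^+ 2 + 2 * alpha * delta) / (1 + p) <=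
  2 / (1 + q) * alpha ^+ 2 + 18 * delta.
Proof.
move=> a0 a2 d0 p0 q0 qp.
have h := inv1D_perturb q0 p0 (mulr_ge0 (ler0n _ 3) d0) qp.
have v0 : 0 <= (1 + p)^-1 by rewrite invr_ge0 addr_ge0.
have v1 : (1 + p)^-1 <= 1 by rewrite invf_le1 ?lerDl// ltr_wpDr.
have a32 : alpha <= 3 / 2 by nra.
set v := (1 + p)^-1 in h v0 v1 *; set u := (1 + q)^-1 in h *.
have h1 : alpha ^+ 2 * (v - 3 * delta) <= alpha ^+ 2 * u by rewrite ler_wpM2l// sqr_ge0.
have h2 : alpha ^+ 2 * delta <= 2 * delta by rewrite ler_wpM2r.
have h3 : alpha * delta <= 3 / 2 * delta by rewrite ler_wpM2r.
have h4 : alpha * delta * v <= alpha * delta by rewrite ler_piMr// mulr_ge0// ltW.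
have -> : 2 * (alpha ^+ 2 + 2 * alpha * delta) * v =
  2 * (alpha ^+ 2 * (v - 3 * delta)) + 6 * (alpha ^+ 2 * delta)
  + 4 * (alpha * delta * v) by ring.
by lra.
Qed.

End ExponentPerturbation.

Section ExpectationBounds.
Variables (R : realType) (alpha y1 y2 delta : R) (n k : nat).
Hypotheses (alpha0 : 1 < alpha) (alpha2 : alpha ^+ 2 <= 2).
Hypotheses (hy1 : 0 <= y1 <= 1) (hy2 : 0 <= y2 <= 1).
Hypotheses (delta0 : 0 < delta) (delta1 : delta <= 1).
Hypothesis k0 : (0 < k)%N.

Let L : R := ln n%:R.
Let K : R := k%:R.
Hypothesis ln2L : ln 2 <= delta * L.

Let K0 : 0 < K. Proof. by rewrite ltr0n. Qed.
Let L0 : 0 < L.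
Proof.
have : 0 < delta * L by rewrite (lt_le_trans _ ln2L)// ln_gt0// ltr1n.
by rewrite pmulr_rgt0.
Qed.
Let KL0 : 0 < K * L. Proof. exact: mulr_gt0. Qed.
Let n0 : (0 < n)%N.
Proof. by rewrite lt0n; apply/eqP => nE; move: L0; rewrite /L nE ln0// ltxx. Qed.
Let nE : n%:R = expR L. Proof. by rewrite lnK// posrE ltr0n. Qed.

(** As [m > (y - delta) * k], [n ^ (k - m)] costs [1 - y + delta] in the exponent; [n ^ k] costs 1,
    and [2 ^ k] at most [delta] by [ln2L]. *)
Lemma near_pairs_le y :
  #|ksubset_pairs n k (overlap_near k delta y)|%:R
    <= expR ((2 - y + 2 * delta) * (K * L)).
Proof.
apply: (le_trans (@card_ksubset_pairs_le _ _ _ _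
  (expR ((1 - y + delta) * (K * L))) (expR_ge0 _) _)).
  move=> m mk; rewrite /overlap_near in_itv/= => /andP[ym _].
  rewrite natrX nE -expRM_natl ler_expR natrB// mulrA ler_pM2r// -/K.
  move: ym; rewrite ltr_pdivlMr// -/K; lra.
have -> : (2 ^ k)%:R = expR (K * ln 2) by rewrite expRM_natl lnK ?posrE// natrX.
rewrite natrX nE -expRM_natl -!expRD ler_expR -/K.
have : K * ln 2 <= K * (delta * L) by rewrite ler_pM2l.
lra.
Qed.

(** The last assumption reads [n - 2k >= k * n ^ (1 - delta)]: its factor [k] cancels the [k ^ j] of
    the counting bound, leaving [n ^ ((1 - delta) * j)] with [j = 2k - m]. *)
Lemma pairs_ge y m : (m <= k)%N -> m%:R / K < y + delta -> 0 <= y <= 1 ->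
  expR ((1 - delta) * L) * K <= n%:R - 2 * K ->
  expR ((2 - y - 3 * delta) * (K * L)) <= #|ksubset_pairs n k (pred1 m)|%:R.
Proof.
move=> mk my hy big.
have k2n : (k.*2 <= n)%N.
  rewrite -(ler_nat R) -mul2n natrM -/K.
  have : 0 <= expR ((1 - delta) * L) * K by rewrite mulr_ge0 ?expR_ge0// ltW.
  lra.
have := card_ksubset_pairs_ge n mk; rewrite -(ler_nat R) natrM !natrX.
set j := (k + (k - m))%N => h.
have jE : j%:R = 2 * K - m%:R by rewrite /j natrD natrB// -/K; ring.
have kj0 : 0 < K ^+ j by rewrite exprn_gt0.
rewrite -(ler_pM2l kj0); apply: le_trans h.
have big' : expR ((1 - delta) * L) * K <= (n - k.*2)%:R.
  by rewrite natrB// -mul2n natrM.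
apply: (@le_trans _ _ ((expR ((1 - delta) * L) * K) ^+ j)); last first.
  by rewrite lerXn2r// nnegrE// mulr_ge0 ?expR_ge0// ltW.
rewrite exprMn mulrC ler_pM2r// -expRM_natl ler_expR jE.
have mK : m%:R < (y + delta) * K by move: my; rewrite ltr_pdivrMr.
rewrite !mulrA ler_pM2r//.
have h1 : (2 - y - 3 * delta) * K <= (1 - delta) * (2 - y - delta) * K.
  have yd : 0 <= y * delta by case/andP: hy => y0 _; rewrite mulr_ge0// ltW.
  by rewrite ler_pM2r//; have := sqr_ge0 delta; lra.
apply: (le_trans h1).
have h2 : (2 - y - delta) * K <= 2 * K - m%:R by lra.
have d1 : 0 <= 1 - delta by rewrite subr_ge0.
have := ler_wpM2l d1 h2; lra.
Qed.

Let q := y1 * y2.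
Let q0 : 0 <= q.
Proof. by case/andP: hy1 => ? _; case/andP: hy2 => ? _; rewrite mulr_ge0. Qed.

(** The excess is [delta * (y1 + y2) + delta ^+ 2], at most [3 * delta] because [y1], [y2] and
    [delta] are at most 1. *)
Let overlap_product_le (a b : R) : 0 <= a -> 0 <= b ->
  a < y1 + delta -> b < y2 + delta -> a * b <= q + 3 * delta.
Proof.
move=> a0 b0 ay bY.
have h : a * b <= (y1 + delta) * (y2 + delta) by rewrite ler_pM// ltW.
apply: (le_trans h); rewrite /q.
have /andP[? ?] := hy1; have /andP[? ?] := hy2; have := delta0; have := delta1.
nra.
Qed.

Let overlap_product_ge (a b : R) : 0 <= a <= 1 -> 0 <= b <= 1 ->
  y1 - delta < a -> y2 - delta < b -> q <= a * b + 3 * delta.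
Proof.
move=> /andP[a0 a1] /andP[b0 b1] ay bY.
have h : q <= (a + delta) * (b + delta).
  have /andP[? ?] := hy1; have /andP[? ?] := hy2.
  by rewrite /q ler_pM//; lra.
apply: (le_trans h).
have := delta0; have := delta1.
nra.
Qed.

Context d (T : measurableType d) (P : probability T R).
Context (C : 'I_n -> 'I_n -> {RV P >-> R}).
Hypothesis hC : standard_gaussian_matrix C.

Let mean := ('E_P[fun w => #|random_overlap_pairs C k alpha y1 y2 delta w|%:R])%E.

(** The error is 22 = 2 + 2 + 18: row pairs, column pairs, and the probability of the window
    event. *)
Lemma expectation_overlap_le :
  (mean <= (expR ((overlap_exponent alpha y1 y2 + 22 * delta) * (K * L)))%:E)%E.
Proof.
apply: (le_trans (@expected_overlap_count_le _ _ _ _ _ C _ _ _ _ _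
  (expR (- ((2 / (1 + q) * alpha ^+ 2 - 18 * delta) * (K * L)))) _)).
  move=> p; rewrite inE => /andP[].
  rewrite !inE /= => /and3P[/eqP I1k /eqP I2k /andP[_ h1]].
  move=> /and3P[/eqP J1k /eqP J2k /andP[_ h2]].
  have da : delta <= alpha by rewrite (le_trans delta1)// ltW.
  apply: (le_trans (avg_window_event_le hC k0 I1k J1k I2k J2k da)).
  rewrite lee_fin ler_expR lerN2 ler_pM2r//.
  apply: tail_exponent_ge => //.
  - by rewrite (lt_trans ltr01).
  - exact: ltW.
  - by apply: overlap_product_le => //; rewrite divr_ge0.
rewrite lee_fin card_row_col_pairs natrM.
apply: (@le_trans _ _ (expR ((2 - y1 + 2 * delta) * (K * L)) *
   expR ((2 - y2 + 2 * delta) * (K * L)) *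
   expR (- ((2 / (1 + q) * alpha ^+ 2 - 18 * delta) * (K * L))))).
  by rewrite ler_wpM2r ?expR_ge0// ler_pM// near_pairs_le.
rewrite -!expRD ler_expR /overlap_exponent -/q; lra.
Qed.

(** Attainability supplies one overlap size [m1] for rows and one [m2] for columns, which suffice.
    The error is 25 = 3 + 3 + 18 + 1, the last unit paying for the mass lost outside the window. *)
Lemma expectation_overlap_ge :
  overlap_attainable k y1 delta -> overlap_attainable k y2 delta ->
  ln 8 <= delta ^+ 2 * L ->
  expR ((1 - delta) * L) * K <= n%:R - 2 * K ->
  ((expR ((overlap_exponent alpha y1 y2 - 25 * delta) * (K * L)))%:E <= mean)%E.
Proof.
move=> [m1 m1k m1y] [m2 m2k m2y] ln8 big.
have K1 : 1 <= K by rewrite ler1n.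
have q12 : q <= m1%:R / K * (m2%:R / K) + 3 * delta.
  move: m1y m2y; rewrite !in_itv/= => /andP[? _] /andP[? _].
  by apply: overlap_product_ge => //; rewrite divr_ge0//= ler_pdivrMr// mul1r ler_nat.
pose B := expR (- ((2 / (1 + q) * alpha ^+ 2 + 18 * delta) * (K * L))) *
  expR (- (delta * (K * L))).
apply: (@le_trans _ _ ((#|row_col_pairs (ksubset_pairs n k (pred1 m1))
    (ksubset_pairs n k (pred1 m2))|)%:R * B)%:E); last first.
  apply: expected_overlap_count_ge.
    apply/fintype.subsetP => p; rewrite !inE/= -!andbA.
    move=> /and5P[-> -> /eqP E1 ->] /andP[-> /eqP E2] /=.
    rewrite /overlap_near E1 E2.
    by move: m1y m2y; rewrite !inE => /andP[-> ->].
  move=> p; rewrite !inE/= => /andP[/and3P[/eqP I1k /eqP I2k /eqP E1]].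
  move=> /and3P[/eqP J1k /eqP J2k /eqP E2].
  have a0 : 0 <= alpha by rewrite ltW// (lt_trans ltr01).
  apply: le_trans (avg_window_event_ge hC k0 I1k J1k I2k J2k (ltW delta0) a0).
  rewrite lee_fin; apply: ler_pM; rewrite ?expR_ge0//.
    rewrite ler_expR lerN2 ler_pM2r// E1 E2.
    apply: window_exponent_le => //.
    - by rewrite (lt_trans ltr01).
    - exact: ltW.
  (* The factor [1 - 4 * expR (- (delta ^+ 2 * (K * L)))] is at least 1/2, as [ln8] makes the
     exponential at most 1/8, and [expR (- (delta * (K * L)))] is at most 1/2. *)
  have h1 : expR (- (delta * (K * L))) <= 1 / 2.
    have -> : 1 / 2 = expR (- ln 2) :> R by rewrite expRN lnK ?posrE// div1r.
    rewrite ler_expR lerN2 (le_trans ln2L)//.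
    by rewrite ler_pM2l// ler_peMl// ltW.
  have h2 : expR (- (delta ^+ 2 * (K * L))) <= 1 / 8.
    have -> : 1 / 8 = expR (- ln 8) :> R by rewrite expRN lnK ?posrE// div1r.
    rewrite ler_expR lerN2 (le_trans ln8)//.
    by rewrite ler_pM2l ?exprn_gt0// ler_peMl// ltW.
  by move: h1 h2; rewrite -/K -/L; lra.
rewrite lee_fin card_row_col_pairs natrM.
have {}m1y : m1%:R / K < y1 + delta by move: m1y; rewrite in_itv/= => /andP[].
have {}m2y : m2%:R / K < y2 + delta by move: m2y; rewrite in_itv/= => /andP[].
apply: (@le_trans _ _ (expR ((2 - y1 - 3 * delta) * (K * L)) *
   expR ((2 - y2 - 3 * delta) * (K * L)) * B)).
  rewrite /B -!expRD ler_expR /overlap_exponent -/q; lra.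
rewrite ler_wpM2r ?mulr_ge0 ?expR_ge0// ler_pM ?expR_ge0//; exact: pairs_ge.
Qed.

End ExpectationBounds.

(** * Choice of the threshold on [n] *)

Lemma ln_natr_eventually_ge (R : realType) (A : R) :
  exists n0 : nat, (0 < n0)%N /\ forall n, (n0 <= n)%N -> A <= ln n%:R.
Proof.
exists (Num.truncn (expR A)).+1; split => // n n0n.
have An : expR A <= n%:R.
  by rewrite (le_trans (ltW (truncnS_gt _)))// ler_nat.
by rewrite -[A]expRK ler_ln// posrE ?expR_gt0// (lt_le_trans (expR_gt0 A)).
Qed.

(** For the last claim write [n = n ^ (1 - delta) * n ^ delta]. The terms in [K] total at most
    [3 * c * log n * n ^ (1 - delta)], and [n ^ delta] outgrows [3 * c * log n]. *)
Lemma eventually_large (R : realType) (delta c A : R) :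
    0 < delta -> delta <= 1 -> 0 < c ->
  exists n0 : nat, (0 < n0)%N /\ forall n, (n0 <= n)%N ->
    [/\ ln 2 <= delta * ln n%:R, ln 8 <= delta ^+ 2 * ln n%:R, A <= ln n%:R &
     forall K : R, K <= c * ln n%:R ->
       expR ((1 - delta) * ln n%:R) * K <= n%:R - 2 * K].
Proof.
move=> d0 d1 c0.
have d20 : 0 < delta ^+ 2 by rewrite exprn_gt0.
have [n1 [_ h1]] := ln_natr_eventually_ge (ln 2 / delta).
have [n2 [_ h2]] := ln_natr_eventually_ge (ln 8 / delta ^+ 2).
have [n3 [_ h3]] := ln_natr_eventually_ge A.
(* With this bound on [L = ln n], [(delta * L / 2) ^+ 2] is at least [3 * c * L]. *)
have [n4 [_ h4]] := ln_natr_eventually_ge (12 * c / delta ^+ 2).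
exists (n1 + n2 + n3 + n4).+1; split => // n nn.
have {}h1 : ln 2 / delta <= ln n%:R by apply: h1; lia.
have {}h2 : ln 8 / delta ^+ 2 <= ln n%:R by apply: h2; lia.
have {}h3 : A <= ln n%:R by apply: h3; lia.
have {}h4 : 12 * c / delta ^+ 2 <= ln n%:R by apply: h4; lia.
have n0 : 0 < n%:R :> R by rewrite ltr0n; lia.
have nE : n%:R = expR (ln n%:R) :> R by rewrite lnK.
move: h1 h2 h4; rewrite !ler_pdivrMr// => h1 h2 h4.
set L : R := ln n%:R in h1 h2 h3 h4 nE *.
have L0 : 0 <= L.
  have : 0 <= L * delta by rewrite (le_trans _ h1)// ln_ge0// ler1n.
  by rewrite pmulr_lge0.
split; [by rewrite mulrC|by rewrite mulrC|by []|move=> K KcL].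
(* [expR x >= (x / 2) ^+ 2] at [x = delta * L] *)
have h5 : 3 * (c * L) <= expR (delta * L).
  have -> : expR (delta * L) = expR (delta * L / 2) ^+ 2.
    by rewrite -expRM_natr divfK.
  have e1 := expR_ge1Dx (delta * L / 2).
  have dL : 0 <= delta * L by rewrite mulr_ge0// ltW.
  have e2 : (delta * L / 2) ^+ 2 <= expR (delta * L / 2) ^+ 2.
    by rewrite lerXn2r ?nnegrE ?expR_ge0//; lra.
  apply: le_trans e2.
  have := ler_wpM2l L0 h4.
  by have -> : (delta * L / 2) ^+ 2 = L * (L * delta ^+ 2) / 4 by [field]; lra.
have E1 : 1 <= expR ((1 - delta) * L).
  by rewrite -[leLHS]expR0 ler_expR mulr_ge0// subr_ge0.
have EK : expR ((1 - delta) * L) * K <= expR ((1 - delta) * L) * (c * L).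
  by rewrite ler_wpM2l ?expR_ge0.
have cL0 : 0 <= c * L by rewrite mulr_ge0// ltW.
have EcL := ler_wpM2r cL0 E1.
have nE' : n%:R = expR ((1 - delta) * L) * expR (delta * L).
  by rewrite nE -expRD; congr expR; ring.
have := ler_wpM2l (expR_ge0 ((1 - delta) * L)) h5.
by rewrite -nE'; lra.
Qed.

Theorem theorem2p4 (R : realType) (alpha y1 y2 : R)
    (halpha : 1 < alpha < Num.sqrt 2)
    (hy1 : 0 <= y1 <= 1) (hy2 : 0 <= y2 <= 1) :
  (forall eps c : R, 0 < eps -> 0 < c ->
    exists (delta : R) (n0 : nat), 0 < delta /\ (0 < n0)%N /\
    forall n k : nat, (n0 <= n)%N -> (0 < k)%N -> k%:R <= c * ln n%:R ->
    overlap_attainable k y1 delta -> overlap_attainable k y2 delta ->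
    forall (d : measure_display) (T : measurableType d) (P : probability T R)
      (C : 'I_n -> 'I_n -> {RV P >-> R}), standard_gaussian_matrix C ->
    (`| lne 'E_P[fun w =>
             #|random_overlap_pairs C k alpha y1 y2 delta w|%:R]
          / (k%:R * ln n%:R)%:E
        - (overlap_exponent alpha y1 y2)%:E | < eps%:E)%E) /\
  (overlap_exponent alpha y1 y2 < 0 ->
    forall eps c : R, 0 < eps -> 0 < c ->
    exists (delta : R) (n0 : nat), 0 < delta /\ (0 < n0)%N /\
    forall n k : nat, (n0 <= n)%N -> (0 < k)%N -> k%:R <= c * ln n%:R ->
    forall (d : measure_display) (T : measurableType d) (P : probability T R)
      (C : 'I_n -> 'I_n -> {RV P >-> R}), standard_gaussian_matrix C ->
    (P [set w | random_overlap_pairs C k alpha y1 y2 delta w != finset.set0]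
       < eps%:E)%E).
Proof.
have /andP[alpha1 alphas] := halpha.
have alpha2 : alpha ^+ 2 <= 2.
  rewrite -[leRHS]sqr_sqrtr// lerXn2r ?nnegrE ?sqrtr_ge0// ltW//.
  exact: lt_trans alpha1.
set f := overlap_exponent alpha y1 y2.
split=> [eps c eps0 c0|f0 eps c eps0 c0].
  (* Both errors, [22 * delta] and [25 * delta], are then at most [eps / 2]. *)
  pose delta := Num.min 1 (eps / 50).
  have delta0 : 0 < delta by rewrite lt_min ltr01 divr_gt0.
  have delta1 : delta <= 1 by rewrite ge_min lexx.
  have deltae : delta <= eps / 50 by rewrite ge_min lexx orbT.
  have [n0 [n00 h]] := eventually_large 0 delta0 delta1 c0.
  exists delta, n0; do 2!split => //.
  move=> n k n0n k0 kc at1 at2 d T P C hC.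
  have [ln2 ln8 _ big] := h n n0n.
  have K0 : 0 < k%:R :> R by rewrite ltr0n.
  have L0 : 0 < ln n%:R :> R by rewrite -(pmulr_rgt0 _ c0) (lt_le_trans K0).
  have KL0 : 0 < k%:R * ln n%:R :> R by rewrite mulr_gt0.
  have := expectation_overlap_le alpha1 alpha2 hy1 hy2 delta0 delta1 k0 ln2 hC.
  have := expectation_overlap_ge alpha1 alpha2 hy1 hy2 delta0 delta1 k0 ln2 hC
    at1 at2 ln8 (big _ kc).
  set E := ('E_P[_])%E; rewrite -/f.
  (* The two bounds exclude infinite values, and the lower one makes [e] positive, so [lne] is the
     real logarithm. *)
  case: E => [e| |//]; last by rewrite leye_eq.
  rewrite !lee_fin => loE upE.
  have e0 : 0 < e by rewrite (lt_le_trans (expR_gt0 _) loE).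
  rewrite lne_EFin// inver gt_eqF// -EFinM -EFinB lte_fin.
  move: loE upE; rewrite -[in _ <= e](lnK e0) -[in e <= _](lnK e0) !ler_expR => lo up.
  rewrite -ler_pdivlMr// in lo; rewrite -ler_pdivrMr// in up.
  by rewrite ltr_norml; apply/andP; split; lra.
(* As 44 is twice 22, the exponent of the upper bound stays at most [f / 2 < 0]. *)
pose delta := Num.min 1 (- f / 44).
have delta0 : 0 < delta by rewrite lt_min ltr01 divr_gt0// oppr_gt0.
have delta1 : delta <= 1 by rewrite ge_min lexx.
have deltaf : delta <= - f / 44 by rewrite ge_min lexx orbT.
(* Since [f < 0], [ln n > 2 * ln eps / f] means [f / 2 * ln n < ln eps]; the added 1 makes the
   inequality strict. *)
have [n0 [n00 h]] := eventually_large (2 * ln eps / f + 1) delta0 delta1 c0.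
exists delta, n0; do 2!split => //.
move=> n k n0n k0 kc d T P C hC.
have [ln2 _ lnA _] := h n n0n.
have K1 : 1 <= k%:R :> R by rewrite ler1n.
have L0 : 0 < ln n%:R :> R.
  by rewrite -(pmulr_rgt0 _ c0) (lt_le_trans _ kc)// ltr0n.
apply: (le_lt_trans (overlap_nonempty_le_expectation _ _ _ _ _ _)).
have := expectation_overlap_le alpha1 alpha2 hy1 hy2 delta0 delta1 k0 ln2 hC.
move=> /le_lt_trans; apply; rewrite -/f lte_fin -[ltRHS]lnK ?posrE// ltr_expR.
have f2 : f + 22 * delta <= f / 2 by lra.
(* The factor [k >= 1] only lowers a negative exponent, so the bound is uniform in [k]. *)
apply: (@le_lt_trans _ _ (f / 2 * ln n%:R)).
  apply: (@le_trans _ _ (f / 2 * (k%:R * ln n%:R))).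
    by rewrite ler_wpM2r// mulr_ge0// ltW.
  by rewrite ler_wnM2l ?ler_peMl ?(ltW L0)// pmulr_lle0// ltW.
have : 2 * ln eps / f < ln n%:R by lra.
rewrite ltr_ndivrMr//; lra.
Qed.
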